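(* Let $0<p<1$, let $I\subseteq\mathbb{R}$ be an interval, and let $k\geq 1$ be an integer. Let $W^{k,p}$ and $W^{k-1,p}$ be the Sobolev spaces on $I$ defined as abstract completions, let $\alpha: W^{k,p}\to L^p(I)$ and $\delta: W^{k,p}\to W^{k-1,p}$ be the canonical maps $\alpha\{f_j\}=\lim_j f_j$ (limit in $L^p(I)$) and $\delta\{f_j\}=\{f_j'\}$, and let $\beta: L^p(I)\to W^{k,p}$ be a linear, continuous, injective map satisfying $\alpha\circ\beta=\mathrm{id}_{L^p(I)}$ and $\delta\circ\beta=0$. Then the mapping $\delta: W^{k,p}\to W^{k-1,p}$ is surjective, and $\ker\delta=\operatorname{im}\beta$.
   Context: Throughout $0<p<1$ and $I\subseteq\mathbb{R}$ is an interval (possibly all of $\mathbb{R}$). Write $\|f\|_p=\left(\int_I |f|^p\,dx\right)^{1/p}$ for the $L^p(I)$ quasi-norm. For an integer $k\geq 0$, $W^{k,p}=W^{k,p}(I)$ is the abstract completion of the space of restrictions to $I$ of functions in $C_0^\infty(\mathbb{R})$ (smooth compactly supported functions on $\mathbb{R}$) with respect to the quasi-norm $$\|f\|_{W^{k,p}}=\left(\|f\|_p^p+\|f'\|_p^p+\cdots+\|f^{(k)}\|_p^p\right)^{1/p}.$$ Thus elements of $W^{k,p}$ are Cauchy sequences $\{f_j\}$ of such functions in this quasi-norm, where two sequences $\{f_j\}$ and $\{g_j\}$ are identified if $\|f_j-g_j\|_{W^{k,p}}\to 0$ as $j\to\infty$. The quasi-norm extends to $W^{k,p}$ by $\|\{f_j\}\|_{W^{k,p}}=\lim_j\|f_j\|_{W^{k,p}}$.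 For $k=0$, $W^{0,p}$ is identified with $L^p(I)$. For $k\geq1$ and $f=\{f_j\}\in W^{k,p}$, the sequence $\{f_j\}$ is Cauchy in $L^p(I)$ and $\{f_j'\}$ is Cauchy in $W^{k-1,p}$, so the maps $\alpha: W^{k,p}\to L^p(I)$, $\alpha f=\lim_j f_j$ (limit in $L^p(I)$), and $\delta: W^{k,p}\to W^{k-1,p}$, $\delta f=\{f_j'\}$, are well defined; they are linear and continuous. (The map $\alpha$ is not injective in general.) It is a known result of Peetre that, for every $k\geq1$, there exists a map $\beta: L^p(I)\to W^{k,p}$ that is linear, continuous, injective and satisfies $\alpha\circ\beta=\mathrm{id}$ and $\delta\circ\beta=0$. *)

(* Defs.v *)
From HB Require Import structures.
From mathcomp Require Import all_boot all_order all_algebra.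
From mathcomp Require Import all_classical all_reals all_analysis.
From mathcomp Require Import measurable_realfun.

Set Implicit Arguments.
Unset Strict Implicit.
Unset Printing Implicit Defensive.

Import Order.TTheory GRing.Theory Num.Theory.
Import numFieldNormedType.Exports.

Local Open Scope classical_set_scope.
Local Open Scope ring_scope.
Local Open Scope quotient_scope.

Section powR_facts.
Context (R : realType).
Implicit Types a b p r : R.

Lemma powR_subadd p a b : 0 < p < 1 -> 0 <= a -> 0 <= b ->
  (a + b) `^ p <= a `^ p + b `^ p.
Proof.
move=> /andP[p0 p1] a0 b0.
have [s0|s0] := leP (a + b) 0.
  have -> : a + b = 0 by apply/eqP; rewrite eq_le s0 addr_ge0.
  by rewrite powR0 ?gt_eqF// addr_ge0// powR_ge0.
have key x : 0 <= x -> x <= a + b -> x / (a + b) * (a + b) `^ p <= x `^ p.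
  rewrite le_eqVlt => /predU1P[<- _|x0 xs].
    by rewrite !mul0r powR0 ?gt_eqF.
  have xs0 : 0 < x / (a + b) by rewrite divr_gt0.
  rewrite -[in leRHS](divfK (lt0r_neq0 s0) x) (powRM _ (ltW xs0) (ltW s0)).
  rewrite ler_wpM2r ?powR_ge0// ger1_powR ?(ltW p1)// xs0/=.
  by rewrite ler_pdivrMr ?mul1r.
apply: (le_trans _ (lerD (key a a0 _) (key b b0 _))); rewrite ?lerDl ?lerDr//.
by rewrite -mulrDl -mulrDl mulfV ?mul1r// gt_eqF.
Qed.

Lemma powR_lt_iff r a b : 0 < r -> 0 <= a -> 0 <= b ->
  (a `^ r < b `^ r) = (a < b).
Proof.
move=> r0 a0 b0; apply/idP/idP => [|ab]; last by apply: gt0_ltr_powR.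
apply: contraTT; rewrite -!leNgt => ba.
by apply: ge0_ler_powR; rewrite // ltW.
Qed.

Lemma powRVK r a : r != 0 -> 0 <= a -> (a `^ r) `^ r^-1 = a.
Proof. by move=> r0 a0; rewrite -powRrM mulfV// powRr1. Qed.

Lemma powRKV r a : r != 0 -> 0 <= a -> (a `^ r^-1) `^ r = a.
Proof. by move=> r0 a0; rewrite -powRrM mulVf// powRr1. Qed.

Lemma powR_cvg r (u : R^nat) (l : R) : 0 < r -> (forall j, 0 <= u j) ->
  u @ \oo --> l -> u j `^ r @[j --> \oo] --> l `^ r.
Proof.
move=> r0 u0 ul; have : 0 <= l.
  rewrite -(cvg_lim _ ul)//; apply: limr_ge; first exact: cvgP ul.
  exact: nearW.
rewrite le_eqVlt => /predU1P[l0|l0].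
  rewrite -l0 powR0 ?gt_eqF//; apply/cvgrPdist_lt => e e0.
  have e'0 : 0 < e `^ r^-1 by rewrite powR_gt0.
  move/cvgrPdist_lt : ul => /(_ _ e'0); apply: filterS => j.
  rewrite -l0 !sub0r !normrN (ger0_norm (u0 j)) ger0_norm ?powR_ge0//.
  rewrite -(powR_lt_iff (r := r))// ?powR_ge0//.
  by rewrite powRKV ?gt_eqF// ltW.
have h : {for l, continuous (fun x : R => x `^ r)}; last first.
  exact: (cvg_comp _ _ ul h).
apply: differentiable_continuous; apply/derivable1_diffP.
by apply: derivable_powR; rewrite in_itv/= l0.
Qed.

End powR_facts.

Section qnorm.
Context (R : realType).

(* A p-norm, 0 < p < 1: a homogeneous functional whose p-th power is           *)
(* subadditive, hence a quasi-norm.                                            *)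
Record qnorm (p : R) (p01 : 0 < p < 1) (V : lmodType R) := QNorm {
  qn :> V -> R ;
  qn_ge0 : forall x, 0 <= qn x ;
  qnZ : forall a x, qn (a *: x) = `|a| * qn x ;
  qnD : forall x y, qn (x + y) `^ p <= qn x `^ p + qn y `^ p }.

Context (p : R) (p01 : 0 < p < 1) (V : lmodType R) (N : qnorm p01 V).

Lemma p_gt0 : 0 < p. Proof. by case/andP: p01. Qed.

Lemma p_neq0 : p != 0. Proof. by rewrite gt_eqF// p_gt0. Qed.

Lemma qn0 : N 0 = 0.
Proof. by rewrite -(scale0r 0) qnZ normr0 mul0r. Qed.

Lemma qnN x : N (- x) = N x.
Proof. by rewrite -scaleN1r qnZ normrN normr1 mul1r. Qed.

Lemma qnpB x y : `|N x `^ p - N y `^ p| <= N (x - y) `^ p.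
Proof.
have h u v : N u `^ p - N v `^ p <= N (u - v) `^ p.
  by rewrite lerBlDr -{1}(subrK v u) qnD.
by rewrite ler_norml h andbT lerNl opprB -[N (x - y)]qnN opprB h.
Qed.

Lemma qn_eq0_l x y : N (x - y) = 0 -> N x = N y.
Proof.
move=> xy0; have := qnpB x y; rewrite xy0 powR0 ?p_neq0// normr_le0 subr_eq0.
by move=> /eqP/powR_injective; apply; rewrite ?p_gt0// nnegrE qn_ge0.
Qed.

Definition qnull : {pred V} := [pred x | N x == 0].

Lemma qnull_submod_closed : submod_closed qnull.
Proof.
split=> [|a x y]; rewrite !inE ?qn0// => /eqP x0 /eqP y0.
have := qnD N (a *: x) y; rewrite qnZ x0 y0 mulr0 powR0 ?p_neq0// addr0.
by move=> h; apply/eqP/(@powR_eq0_eq0 _ _ p)/eqP; rewrite eq_le h powR_ge0.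
Qed.

HB.instance Definition _ :=
  GRing.isSubmodClosed.Build R V qnull qnull_submod_closed.

(* The separated quotient of V by the vectors of quasi-norm zero.              *)
Definition sepquot : Type := Quotient.quot qnull.

HB.instance Definition _ := Choice.on sepquot.
HB.instance Definition _ := EqQuotient.on sepquot.
HB.instance Definition _ := GRing.Zmodule.on sepquot.
HB.instance Definition _ := ZmodQuotient.on sepquot.

Lemma sepquotP (x y : V) : \pi_sepquot x = \pi_sepquot y <-> N (x - y) = 0.
Proof.
by split=> [/eqP|/eqP xy]; [rewrite -Quotient.idealrBE => /eqP|
  apply/eqP; rewrite -Quotient.idealrBE].
Qed.

Definition sepquot_scale (a : R) (x : sepquot) : sepquot :=
  \pi_sepquot (a *: repr x).

Lemma pi_sepquot_scale a x :
  sepquot_scale a (\pi_sepquot x) = \pi_sepquot (a *: x).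
Proof.
apply/sepquotP; rewrite -scalerBr qnZ.
have /sepquotP -> : \pi_sepquot (repr (\pi_sepquot x)) = \pi_sepquot x.
  by rewrite reprK.
by rewrite mulr0.
Qed.

Lemma sepquot_scaleA a b x :
  sepquot_scale a (sepquot_scale b x) = sepquot_scale (a * b) x.
Proof.
rewrite -[x]reprK (pi_sepquot_scale b) (pi_sepquot_scale a) scalerA.
by rewrite (pi_sepquot_scale (a * b)).
Qed.

Lemma sepquot_scale1 : left_id 1 sepquot_scale.
Proof.
by move=> x; rewrite -[in LHS](reprK x) pi_sepquot_scale scale1r reprK.
Qed.

Lemma sepquot_scaleDr : right_distributive sepquot_scale +%R.
Proof.
move=> a x y; rewrite -[x]reprK -[y]reprK -raddfD !pi_sepquot_scale.
by rewrite scalerDr raddfD.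
Qed.

Lemma sepquot_scaleDl x : {morph sepquot_scale^~ x : a b / a + b}.
Proof.
by move=> a b; rewrite -[x]reprK !pi_sepquot_scale scalerDl raddfD.
Qed.

HB.instance Definition _ := GRing.Zmodule_isLmodule.Build R sepquot
  sepquot_scaleA sepquot_scale1 sepquot_scaleDr sepquot_scaleDl.

Definition sepquot_norm (x : sepquot) : R := N (repr x).

Lemma sepquot_norm_pi x : sepquot_norm (\pi_sepquot x) = N x.
Proof. by apply: qn_eq0_l; apply/sepquotP; rewrite reprK. Qed.

(* The topology of the quasi-norm, by means of the metric |x - y|^p.           *)
Definition sepquot_dist (x y : sepquot) : R := sepquot_norm (x - y) `^ p.

Lemma sepquot_distxx x : sepquot_dist x x = 0.
Proof.
rewrite /sepquot_dist subrr -(raddf0 \pi_sepquot) sepquot_norm_pi qn0.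
by rewrite powR0 ?p_neq0.
Qed.

Lemma sepquot_dist_positivity x y : sepquot_dist x y = 0 -> x = y.
Proof.
rewrite /sepquot_dist -[x]reprK -[y]reprK -raddfB sepquot_norm_pi.
by move=> /powR_eq0_eq0/sepquotP.
Qed.

Lemma sepquot_dist_sym x y : sepquot_dist x y = sepquot_dist y x.
Proof.
rewrite /sepquot_dist -[x]reprK -[y]reprK -!raddfB !sepquot_norm_pi.
by rewrite -opprB qnN.
Qed.

Lemma sepquot_dist_triangle y x z :
  sepquot_dist x z <= sepquot_dist x y + sepquot_dist y z.
Proof.
rewrite /sepquot_dist -[x]reprK -[y]reprK -[z]reprK -!raddfB.
by rewrite !sepquot_norm_pi (le_trans _ (qnD N _ _))// addrA subrK.
Qed.

HB.instance Definition _ := @isMetric.Build R sepquot sepquot_dist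
  sepquot_distxx sepquot_dist_positivity sepquot_dist_sym sepquot_dist_triangle.

HB.instance Definition _ := isPointed.Build sepquot 0.

End qnorm.

Section completion.
Context (R : realType) (p : R) (p01 : 0 < p < 1) (V : lmodType R).
Variable N : qnorm p01 V.

Definition is_cauchy (u : nat -> V) : Prop := forall e : R, 0 < e ->
  exists n0, forall m n, (n0 <= m)%N -> (n0 <= n)%N -> N (u m - u n) < e.

Definition cauchypred : {pred nat -> V} := [pred u | `[< is_cauchy u >]].

Lemma is_cauchyP (u : nat -> V) : is_cauchy u <-> (forall e : R, 0 < e ->
  exists n0, forall m n, (n0 <= m)%N -> (n0 <= n)%N ->
  N (u m - u n) `^ p < e).
Proof.
have pg0 := p_gt0 p01; have pn0 := p_neq0 p01.
split=> uC e e0.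
  have [n0 h] := uC _ (powR_gt0 p^-1 e0); exists n0 => m n nm nn.
  have := h m n nm nn; rewrite -(powR_lt_iff pg0) ?qn_ge0 ?powR_ge0//.
  by rewrite powRKV ?ltW.
have [n0 h] := uC _ (powR_gt0 p e0); exists n0 => m n nm nn.
by have := h m n nm nn; rewrite powR_lt_iff ?qn_ge0// ltW.
Qed.

Lemma cauchypred_submod_closed : submod_closed cauchypred.
Proof.
split=> [|a u v]; rewrite !inE.
  by move=> e e0; exists 0%N => m n _ _; rewrite subrr qn0.
move=> /is_cauchyP uC /is_cauchyP vC; apply/is_cauchyP => e e0.
have a0 : 0 < (`|a| + 1) `^ p by rewrite powR_gt0// ltr_pwDr.
have [n1 h1] : exists n0, forall m n, (n0 <= m)%N -> (n0 <= n)%N ->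
    N (u m - u n) `^ p < e / 2 / (`|a| + 1) `^ p.
  by apply: uC; rewrite !divr_gt0.
have [n2 h2] : exists n0, forall m n, (n0 <= m)%N -> (n0 <= n)%N ->
    N (v m - v n) `^ p < e / 2.
  by apply: vC; rewrite divr_gt0.
exists (maxn n1 n2) => m n; rewrite !geq_max => /andP[m1 m2] /andP[k1 k2].
have -> : (a *: u + v) m - (a *: u + v) n =
    a *: (u m - u n) + (v m - v n) by rewrite scalerBr opprD addrACA.
rewrite (le_lt_trans (qnD N _ _))// (splitr e) ltrD ?h2// qnZ.
have := h1 m n m1 k1; rewrite ltr_pdivlMr//; apply: le_lt_trans.
rewrite powRM ?qn_ge0// mulrC ler_wpM2l ?powR_ge0//.
by apply: ge0_ler_powR; rewrite ?nnegrE ?addr_ge0 ?lerDl// ltW// p_gt0.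
Qed.

HB.instance Definition _ := GRing.isSubmodClosed.Build R (nat -> V) cauchypred
  cauchypred_submod_closed.

Record cauchyseq := CauchySeq {
  cauchyseq_val :> nat -> V ; cauchyseq_valP : cauchyseq_val \in cauchypred }.

HB.instance Definition _ := [isSub for cauchyseq_val].
HB.instance Definition _ := [Choice of cauchyseq by <:].
HB.instance Definition _ := [SubChoice_isSubLmodule of cauchyseq by <:].

Lemma cauchyseqP (u : cauchyseq) : is_cauchy u.
Proof. by have := cauchyseq_valP u; rewrite inE. Qed.

Lemma cauchyseq_norm_is_cvg (u : cauchyseq) : cvgn (fun j => N (u j)).
Proof.
suff : cvgn (fun j => N (u j) `^ p).
  move=> /cvg_ex[l ul]; apply/cvg_ex; exists (l `^ p^-1).
  have pV0 : 0 < p^-1 by rewrite invr_gt0 (p_gt0 p01).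
  have := powR_cvg pV0 (fun j => powR_ge0 (N (u j)) p) ul.
  by under eq_fun do rewrite powRVK ?qn_ge0 ?(p_neq0 p01)//.
apply: cauchy_cvg; apply: cauchy_exP => e e0.
have /is_cauchyP/(_ _ e0)[n0 h] := cauchyseqP u.
exists (N (u n0) `^ p), n0 => // n /= nn.
by rewrite /ball/= (le_lt_trans (qnpB N _ _))// h.
Qed.

Definition cauchyseq_norm (u : cauchyseq) : R := limn (fun j => N (u j)).

Lemma cauchyseq_norm_ge0 u : 0 <= cauchyseq_norm u.
Proof.
apply: limr_ge; first exact: cauchyseq_norm_is_cvg.
by apply: nearW => j; exact: qn_ge0.
Qed.

Lemma cauchyseq_normZ a u : cauchyseq_norm (a *: u) = `|a| * cauchyseq_norm u.
Proof.
apply/cvg_lim => //=; under eq_fun do rewrite qnZ.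
by apply: cvgMr; exact: cauchyseq_norm_is_cvg.
Qed.

Lemma cauchyseq_normpE (u : cauchyseq) :
  N (u j) `^ p @[j --> \oo] --> cauchyseq_norm u `^ p.
Proof.
apply: powR_cvg; [exact: p_gt0|by move=> j; exact: qn_ge0|].
exact: cauchyseq_norm_is_cvg.
Qed.

Lemma cauchyseq_normD (u v : cauchyseq) : cauchyseq_norm (u + v) `^ p <=
  cauchyseq_norm u `^ p + cauchyseq_norm v `^ p.
Proof.
have uv := cvgD (FF := eventually_filter) (@cauchyseq_normpE u)
  (@cauchyseq_normpE v).
rewrite -(cvg_lim _ uv)// -(cvg_lim _ (@cauchyseq_normpE (u + v)))//.
apply: ler_lim; [exact: cvgP (@cauchyseq_normpE _)|exact: cvgP uv|].
by apply: nearW => j; exact: qnD.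
Qed.

Definition cauchyseq_qnorm : qnorm p01 cauchyseq :=
  QNorm p01 cauchyseq_norm_ge0 cauchyseq_normZ cauchyseq_normD.

(* Cauchy sequences u and v being identified when N (u j - v j) tends to 0.    *)
Definition completion : Type := sepquot cauchyseq_qnorm.

HB.instance Definition _ := Choice.on completion.
HB.instance Definition _ := EqQuotient.on completion.
HB.instance Definition _ := GRing.Lmodule.on completion.
HB.instance Definition _ := Metric.on completion.
HB.instance Definition _ := Pointed.on completion.

Lemma completionP (u v : cauchyseq) :
  \pi_completion u = \pi_completion v <-> N (u j - v j) @[j --> \oo] --> 0.
Proof.
have uv := @cauchyseq_norm_is_cvg (u - v).
by split => [/sepquotP <- //|h]; apply/sepquotP; exact: cvg_lim h.
Qed.

End completion.

Section Lp.
Context d (T : measurableType d) (R : realType).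
Variable mu : {measure set T -> \bar R}.
Context (p : R) (p01 : 0 < p < 1).

Lemma Lfun_ltP (f : T -> R) : f \in Lfun mu p%:E <->
  measurable_fun setT f /\ (\int[mu]_x (`|f x| `^ p)%:E < +oo)%E.
Proof.
have pn0 := p_neq0 p01.
have NE : ('N[mu]_p%:E[EFin \o f] `^ p = \int[mu]_x (`|f x| `^ p)%:E)%E.
  by rewrite powR_Lnorm.
split=> [/andP[]|[mf foo]].
  rewrite !inE => mf; rewrite /= /finite_norm => /(@poweR_lty _ _ p).
  by rewrite NE.
apply/andP; split; rewrite inE//= /finite_norm.
by apply: (lty_poweRy pn0); rewrite NE.
Qed.

Definition Lppred of 0 < p < 1 : {pred T -> R} := Lfun mu p%:E.

Local Notation J f := (\int[mu]_x (`|f x| `^ p)%:E)%E.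

Let mpow (f : T -> R) : measurable_fun setT f ->
  measurable_fun setT ((fun x => (`|f x| `^ p)%:E) : T -> \bar R).
Proof.
move=> mf; apply/measurable_EFinP.
by apply: (measurableT_comp (measurable_powR p)); exact: measurableT_comp.
Qed.

Lemma integral_powRD (f g : T -> R) :
  measurable_fun setT f -> measurable_fun setT g ->
  (J (f \+ g)%R <= J f + J g)%E.
Proof.
move=> mf mg.
rewrite -ge0_integralD//; [|exact: mpow|exact: mpow].
apply: ge0_le_integral => //.
- by apply: mpow; exact: measurable_funD.
- by apply: emeasurable_funD; exact: mpow.
- move=> x _; rewrite -EFinD lee_fin.
  apply: (le_trans _ (powR_subadd p01 (normr_ge0 _) (normr_ge0 _))).
  apply: ge0_ler_powR; rewrite ?nnegrE ?addr_ge0// ?ler_normD//.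
  by rewrite ltW// p_gt0.
Qed.

Lemma integral_powRZ (a : R) (f : T -> R) : measurable_fun setT f ->
  J (a \*o f)%R = ((`|a| `^ p)%:E * J f)%E.
Proof.
move=> mf; rewrite -ge0_integralZl//; last exact: mpow.
by apply: eq_integral => x _; rewrite -EFinM normrM powRM.
Qed.

Lemma Lppred_submod_closed : submod_closed (Lppred p01).
Proof.
split=> [|a f g].
  apply/Lfun_ltP; split; first exact: measurable_cst.
  rewrite integral0_eq// => x _.
  by rewrite normr0 powR0// (p_neq0 p01).
move=> /Lfun_ltP[mf foo] /Lfun_ltP[mg goo]; apply/Lfun_ltP.
have maf : measurable_fun setT (a \*o f) by exact: measurable_funM.
split; first exact: measurable_funD.
apply: (le_lt_trans (integral_powRD maf mg)); rewrite integral_powRZ//.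
by rewrite lte_add_pinfty// lte_mul_pinfty// lee_fin powR_ge0.
Qed.

HB.instance Definition _ := GRing.isSubmodClosed.Build R (T -> R) (Lppred p01)
  Lppred_submod_closed.

Record Lpfun := MkLpfun {
  Lpfun_val :> T -> R ; Lpfun_valP : Lpfun_val \in Lppred p01 }.

HB.instance Definition _ := [isSub for Lpfun_val].
HB.instance Definition _ := [Choice of Lpfun by <:].
HB.instance Definition _ := [SubChoice_isSubLmodule of Lpfun by <:].

Definition Lp_norm (f : T -> R) : R := fine 'N[mu]_p%:E[EFin \o f].

Lemma Lp_norm_ge0 f : 0 <= Lp_norm f.
Proof. by rewrite fine_ge0// Lnorm_ge0. Qed.

Lemma Lp_normpE f : Lp_norm f `^ p = fine (J f).
Proof. by rewrite -fine_poweR powR_Lnorm// (p_neq0 p01). Qed.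

Lemma Lppred_fin_num (f : T -> R) : f \in Lppred p01 -> J f \is a fin_num.
Proof.
move=> /Lfun_ltP[_ foo]; rewrite ge0_fin_numE//.
by apply: integral_ge0 => x _; rewrite lee_fin powR_ge0.
Qed.

Lemma Lp_normD f g : f \in Lppred p01 -> g \in Lppred p01 ->
  Lp_norm (f + g) `^ p <= Lp_norm f `^ p + Lp_norm g `^ p.
Proof.
move=> Lf Lg; have Lfg : f + g \in Lppred p01 by exact: rpredD.
rewrite !Lp_normpE -fineD ?Lppred_fin_num//.
apply: fine_le; first exact: Lppred_fin_num.
  by rewrite fin_numD (Lppred_fin_num Lf) (Lppred_fin_num Lg).
by move: Lf Lg => /Lfun_ltP[mf _] /Lfun_ltP[mg _]; exact: integral_powRD.
Qed.

Lemma Lp_normZ (a : R) f : f \in Lppred p01 ->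
  Lp_norm (a *: f) = `|a| * Lp_norm f.
Proof.
move=> Lf; have /Lfun_ltP[mf _] := Lf.
apply: (powR_injective (p_gt0 p01)); rewrite ?nnegrE ?mulr_ge0 ?Lp_norm_ge0//.
rewrite powRM ?Lp_norm_ge0// !Lp_normpE (integral_powRZ a mf) fineM//.
exact: Lppred_fin_num.
Qed.

Definition Lp_qnorm : qnorm p01 Lpfun := QNorm p01
  (fun f : Lpfun => Lp_norm_ge0 f)
  (fun a (f : Lpfun) => Lp_normZ a (Lpfun_valP f))
  (fun f g : Lpfun => Lp_normD (Lpfun_valP f) (Lpfun_valP g)).

(* Equality is equality almost everywhere, see LpP. The library's LspaceType   *)
(* is only available for 1 <= p.                                               *)
Definition Lp : Type := sepquot Lp_qnorm.

HB.instance Definition _ := Choice.on Lp.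
HB.instance Definition _ := EqQuotient.on Lp.
HB.instance Definition _ := GRing.Lmodule.on Lp.
HB.instance Definition _ := Metric.on Lp.
HB.instance Definition _ := Pointed.on Lp.

Lemma LpP (f g : Lpfun) : \pi_Lp f = \pi_Lp g <-> ae_eq mu setT f g.
Proof.
pose h : T -> R := (f - g : Lpfun).
have Lh : h \in Lppred p01 by exact: Lpfun_valP (f - g).
have /Lfun_ltP[mh _] := Lh.
have NE : ('N[mu]_p%:E[EFin \o h] = (Lp_norm h)%:E)%E.
  rewrite /Lp_norm fineK// ge0_fin_numE ?Lnorm_ge0//.
  by have /andP[_] := Lh; rewrite inE.
split=> [/sepquotP fg|fg].
  have : ae_eq mu setT (EFin \o h) (cst 0%E).
    apply: (@Lnorm_eq0_eq0 _ _ _ _ _ p%:E); first exact/measurable_EFinP.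
    - by rewrite lte_fin (p_gt0 p01).
    - by rewrite NE; congr EFin.
  apply: filterS => x /= hx _; apply/eqP; rewrite -subr_eq0; apply/eqP.
  by have [] := hx I.
apply/sepquotP; change (Lp_norm h = 0).
suff : Lp_norm h `^ p = 0 by move=> /powR_eq0_eq0.
rewrite Lp_normpE (ae_eq_integral (cst 0%E))//.
- by rewrite integral_cst//= mul0e.
- exact: mpow.
- apply: filterS fg => x /= hx _.
  have -> : h x = f x - g x by [].
  by rewrite hx// subrr normr0 powR0// (p_neq0 p01).
Qed.

End Lp.

Section test_functions.
Context (R : realType).
Implicit Types f g : R -> R.

Definition smooth f : Prop := forall n x, derivable (derive1n n f) x 1.

Definition compactly_supported f : Prop :=
  compact (closure [set x | f x != 0]).

Lemma derive1nE n f : derive1n n.+1 f = derive1n n (f^`()%classic).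
Proof. by rewrite /derive1n iterSr. Qed.

Lemma derive1nD n a f g : smooth f -> smooth g ->
  derive1n n (a *: f + g) = a *: derive1n n f + derive1n n g.
Proof.
move=> sf sg; elim: n => [//|n ih]; rewrite !derive1nS ih.
apply/funext => x; have df := sf n x; have dg := sg n x.
rewrite derive1E deriveD//; last exact: derivableZ.
by rewrite deriveZ// -!derive1E.
Qed.

Lemma derive1n0E n : derive1n n (0 : R -> R) = 0.
Proof.
elim: n => [//|n ih]; rewrite derive1nS ih.
by apply/funext => y; rewrite derive1_cst.
Qed.

Lemma smooth0 : smooth (0 : R -> R).
Proof. by move=> n x; rewrite derive1n0E; exact: derivable_cst. Qed.

Lemma derive1nDE n f g : smooth f -> smooth g ->
  derive1n n (f + g) = derive1n n f + derive1n n g.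
Proof. by move=> sf sg; have := derive1nD n 1 sf sg; rewrite !scale1r. Qed.

Lemma derive1nZE n a f : smooth f -> derive1n n (a *: f) = a *: derive1n n f.
Proof.
by move=> sf; have := derive1nD n a sf smooth0; rewrite derive1n0E !addr0.
Qed.

Definition testpred : {pred R -> R} :=
  [pred f | `[< smooth f /\ compactly_supported f >]].

Lemma testpred_submod_closed : submod_closed testpred.
Proof.
split=> [|a f g]; rewrite !inE.
  split; first exact: smooth0.
  rewrite /compactly_supported (_ : [set x | _] = set0).
    by rewrite closure0; exact: compact0.
  by apply/seteqP; split => x //=; rewrite eqxx.
move=> [sf cf] [sg cg]; split=> [n x|].
  by rewrite derive1nD//; apply: derivableD => //; exact: derivableZ.
apply: (subclosed_compact _ (compactU cf cg)); first exact: closed_closure.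
rewrite -closureU; apply: closure_subset => x /= h.
have [fx|fx] := eqVneq (f x) 0; [right|by left].
apply: contra_neq h => gx; change (a *: f x + g x = 0).
by rewrite fx gx scaler0 addr0.
Qed.

HB.instance Definition _ := GRing.isSubmodClosed.Build R (R -> R) testpred
  testpred_submod_closed.

(* C_0^oo(R): the real-valued smooth functions with compact support.           *)
Record testfun := TestFun {
  testfun_val :> R -> R ; testfun_valP : testfun_val \in testpred }.

HB.instance Definition _ := [isSub for testfun_val].
HB.instance Definition _ := [Choice of testfun by <:].
HB.instance Definition _ := [SubChoice_isSubLmodule of testfun by <:].

Lemma testfun_smooth (f : testfun) : smooth f.
Proof. by have := testfun_valP f; rewrite inE => -[]. Qed.

Lemma testfun_supp (f : testfun) : compactly_supported f.
Proof. by have := testfun_valP f; rewrite inE => -[]. Qed.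

Lemma testpred_derive1 f : f \in testpred -> f^`()%classic \in testpred.
Proof.
rewrite !inE => -[sf cf]; split=> [n x|].
  by rewrite -derive1nE; exact: sf.
apply: (subclosed_compact _ cf); first exact: closed_closure.
rewrite [X in _ `<=` X](iffLR (closure_id _) (@closed_closure _ _)).
apply: closure_subset => x /=; apply: contra_neqP => xf.
rewrite derive1E (@near_eq_derive _ _ _ f (cst 0) x 1) ?derive_cst//.
have : nbhs x (~` closure [set x | f x != 0]).
  by apply: open_nbhs_nbhs; split => //; exact/closed_openC/closed_closure.
apply: filterS => y yf; apply/eqP; apply: contrapT => /negP fy.
by apply: yf; exact: subset_closure.
Qed.

Definition testfun_derive (f : testfun) : testfun :=
  TestFun (testpred_derive1 (testfun_valP f)).

Lemma testpred_derive1n n f : f \in testpred -> derive1n n f \in testpred.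
Proof.
by move=> tf; elim: n => [//|n ih]; rewrite derive1nS testpred_derive1.
Qed.

Lemma testfun_continuous (f : testfun) : continuous f.
Proof.
move=> x; apply: differentiable_continuous; apply/derivable1_diffP.
exact: (@testfun_smooth f 0%N x).
Qed.

Lemma testfun_bounded (f : testfun) : exists M : R,
  (forall x, `|f x| <= M) /\ (forall x, M < `|x| -> f x = 0).
Proof.
have := @testfun_supp f; rewrite /compactly_supported; set K := closure _ => cK.
have cfK : compact (f @` K).
  apply: continuous_compact => //; apply: continuous_subspaceT.
  exact: testfun_continuous.
have /pinfty_ex_gt0[A A0 hA] := compact_bounded cK.
have /pinfty_ex_gt0[B B0 hB] := compact_bounded cfK.
have out x : ~ K x -> f x = 0.
  move=> xK; apply/eqP; apply: contrapT => /negP fx; apply: xK.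
  exact: subset_closure.
exists (Num.max A B); split=> x.
  have [xK|xK] := pselect (K x).
    have fxB : `|f x| <= B by apply: hB; exists x.
    by rewrite (le_trans fxB)// le_max lexx orbT.
  by rewrite out// normr0 le_max (ltW A0).
rewrite gt_max => /andP[Ax _]; apply: out => /hA /=.
by rewrite leNgt Ax.
Qed.

Lemma testfun_deriveB (f g : testfun) :
  testfun_derive (f - g) = testfun_derive f - testfun_derive g.
Proof.
apply: val_inj; apply/funext => x.
change (derive1 (f - g : R -> R) x = derive1 f x - derive1 g x).
rewrite !derive1E; apply: deriveB.
- exact: (@testfun_smooth f 0%N x).
- exact: (@testfun_smooth g 0%N x).
Qed.

End test_functions.

Section sobolev.
Context (R : realType) (I : interval R) (p : R) (p01 : 0 < p < 1).

(* Lebesgue measure restricted to I: functions on I are represented by         *)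
(* functions on R, whose values outside I are then irrelevant.                 *)
Definition lebesgue_on : {measure set (measurableTypeR R) -> \bar R} :=
  mrestr lebesgue_measure (measurable_itv I).

Lemma testfun_Lppred (f : testfun R) :
  (f : measurableTypeR R -> R) \in Lppred lebesgue_on p01.
Proof.
have mf : measurable_fun setT f.
  exact: continuous_measurable_fun (@testfun_continuous _ f).
apply/(Lfun_ltP _ p01); split; first exact: mf.
have [M [fM f0]] := testfun_bounded f.
pose D := `[- M, M]%classic.
have mD : measurable (D : set (measurableTypeR R)) by exact: measurable_itv.
apply: (@le_lt_trans _ _ (\int[lebesgue_on]_x ((M `^ p)%:E * (\1_D x)%:E))%E).
  apply: ge0_le_integral => //.
  - apply/measurable_EFinP; apply: (measurableT_comp (measurable_powR p)).
    exact: measurableT_comp.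
  - apply/measurable_EFinP; apply: measurable_funM => //.
  - move=> x _; rewrite -EFinM lee_fin indicE.
    have [xD|xD] := boolP (x \in D).
      rewrite mulr1; apply: ge0_ler_powR; rewrite ?nnegrE//.
      + by rewrite ltW// (p_gt0 p01).
      + by rewrite (le_trans _ (fM 0)).
    rewrite f0 ?normr0 ?powR0 ?mulr0 ?(p_neq0 p01)//.
    move: xD; rewrite notin_setE /D/= in_itv/= -ler_norml => /negP.
    by rewrite ltNge.
rewrite ge0_integralZl ?lee_fin ?powR_ge0//; last first.
  exact/measurable_EFinP.
rewrite integral_indic// setIT lte_mul_pinfty ?lee_fin ?powR_ge0//.
apply: (@le_lt_trans _ _ (lebesgue_measure D)).
  apply: le_measure; rewrite ?inE//; exact: measurableI.
by rewrite lebesgue_measure_itv/=; case: ifP => //; rewrite -EFinB ltry.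
Qed.

Definition Lp_of_testfun (f : testfun R) : Lpfun lebesgue_on p01 :=
  MkLpfun (testfun_Lppred f).

Local Notation "'N_p f" := (Lp_norm lebesgue_on p f)
  (at level 10, f at level 8).

Definition sobolev_norm (k : nat) (f : testfun R) : R :=
  (\sum_(i < k.+1) ('N_p (derive1n i f)) `^ p) `^ p^-1.

Let sum_ge0 k (f : R -> R) : 0 <= \sum_(i < k.+1) ('N_p (derive1n i f)) `^ p.
Proof. by apply: sumr_ge0 => i _; exact: powR_ge0. Qed.

Lemma sobolev_normpE k f :
  sobolev_norm k f `^ p = \sum_(i < k.+1) ('N_p (derive1n i f)) `^ p.
Proof. by rewrite powRKV// ?sum_ge0// (p_neq0 p01). Qed.

Lemma sobolev_norm_ge0 k f : 0 <= sobolev_norm k f.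
Proof. exact: powR_ge0. Qed.

Let Lp_derive1n i (f : testfun R) :
  (derive1n i f : measurableTypeR R -> R) \in Lppred lebesgue_on p01.
Proof.
exact: (testfun_Lppred (TestFun (testpred_derive1n i (testfun_valP f)))).
Qed.

Lemma sobolev_normD k f g : sobolev_norm k (f + g) `^ p <=
  sobolev_norm k f `^ p + sobolev_norm k g `^ p.
Proof.
have aux (x y z x' y' z' : R) : x = x' -> y = y' -> z = z' ->
  x' <= y' + z' -> x <= y + z by move=> -> -> ->.
apply: (aux _ _ _ _ _ _ (sobolev_normpE k (f + g)) (sobolev_normpE k f)
  (sobolev_normpE k g)).
rewrite -big_split; apply: ler_sum => i _.
have -> : derive1n i (f + g : testfun R) = derive1n i f + derive1n i g.
  by apply: derive1nDE; exact: testfun_smooth.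
by apply: Lp_normD; exact: Lp_derive1n.
Qed.

Lemma sobolev_normZ k a f : sobolev_norm k (a *: f) = `|a| * sobolev_norm k f.
Proof.
apply: (powR_injective (p_gt0 p01)).
- by rewrite nnegrE sobolev_norm_ge0.
- by rewrite nnegrE mulr_ge0// sobolev_norm_ge0.
rewrite powRM ?sobolev_norm_ge0//.
apply: (eq_trans (sobolev_normpE k (a *: f))).
apply: (eq_trans _ (congr1 ( *%R (`|a| `^ p)) (esym (sobolev_normpE k f)))).
rewrite mulr_sumr.
apply: eq_bigr => i _.
have -> : derive1n i (a *: f : testfun R) = a *: derive1n i f.
  by apply: derive1nZE; exact: testfun_smooth.
by rewrite (Lp_normZ _ (Lp_derive1n _ _)) powRM// Lp_norm_ge0.
Qed.

Definition sobolev_qnorm (k : nat) : qnorm p01 (testfun R) :=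
  QNorm p01 (sobolev_norm_ge0 k) (sobolev_normZ k) (@sobolev_normD k).

(* W^{k,p}(I). The test functions are not restricted to I; those with the same *)
(* restriction are at distance 0, hence identified in the completion.          *)
Definition sobolev (k : nat) : Type := completion (sobolev_qnorm k).

HB.instance Definition _ k := Choice.on (sobolev k).
HB.instance Definition _ k := EqQuotient.on (sobolev k).
HB.instance Definition _ k := GRing.Lmodule.on (sobolev k).
HB.instance Definition _ k := Metric.on (sobolev k).
HB.instance Definition _ k := Pointed.on (sobolev k).

Definition LpI : Type := Lp lebesgue_on p01.

HB.instance Definition _ := Choice.on LpI.
HB.instance Definition _ := EqQuotient.on LpI.
HB.instance Definition _ := GRing.Lmodule.on LpI.
HB.instance Definition _ := Metric.on LpI.
HB.instance Definition _ := Pointed.on LpI.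

(* alpha {f_j} = lim f_j in L^p(I); the limit exists as L^p(I) is complete,    *)
(* and alpha_pi shows that it does not depend on the representative.           *)
Definition alpha (k : nat) (w : sobolev k) : LpI :=
  limn (fun j => \pi_LpI (Lp_of_testfun (repr w j))).

Lemma sobolev_norm_derive k f :
  sobolev_norm k (testfun_derive f) <= sobolev_norm k.+1 f.
Proof.
rewrite /sobolev_norm; apply: ge0_ler_powR; rewrite ?nnegrE ?sum_ge0//.
  by rewrite invr_ge0 ltW// (p_gt0 p01).
rewrite [leRHS]big_ord_recl/= ler_wpDl ?powR_ge0//.
by apply: ler_sum => i _; rewrite -derive1nE.
Qed.

Lemma cauchy_derive k (u : cauchyseq (sobolev_qnorm k.+1)) :
  (fun j => testfun_derive (u j)) \in cauchypred (sobolev_qnorm k).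
Proof.
rewrite inE => e e0; have [n0 h] := @cauchyseqP _ _ _ _ _ u _ e0.
exists n0 => m n nm nn; apply: le_lt_trans (h m n nm nn).
by rewrite -testfun_deriveB; exact: sobolev_norm_derive.
Qed.

Definition cauchyseq_derive k (u : cauchyseq (sobolev_qnorm k.+1)) :
  cauchyseq (sobolev_qnorm k) := CauchySeq (cauchy_derive u).

(* delta {f_j} = {f_j'}; see delta_pi.                                         *)
Definition delta (k : nat) (w : sobolev k.+1) : sobolev k :=
  \pi_(sobolev k) (cauchyseq_derive (repr w)).

Lemma delta_pi k (u : cauchyseq (sobolev_qnorm k.+1)) :
  delta (\pi_(sobolev k.+1) u) = \pi_(sobolev k) (cauchyseq_derive u).
Proof.
set v := repr (\pi_(sobolev k.+1) u).
have vu : sobolev_qnorm k.+1 (v j - u j) @[j --> \oo] --> 0.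
  by apply/(completionP (N := sobolev_qnorm k.+1)); rewrite reprK.
apply/(completionP (N := sobolev_qnorm k)) => /=.
apply: (squeeze_cvgr _ (cvg_cst 0) vu); apply: nearW => j.
by rewrite sobolev_norm_ge0/= -testfun_deriveB sobolev_norm_derive.
Qed.

Lemma LpI_dist_le k (f g : testfun R) :
  mdist (\pi_LpI (Lp_of_testfun f)) (\pi_LpI (Lp_of_testfun g)) <=
  sobolev_norm k (f - g) `^ p.
Proof.
have -> : mdist (\pi_LpI (Lp_of_testfun f)) (\pi_LpI (Lp_of_testfun g)) =
    'N_p (derive1n 0 (f - g)) `^ p.
  by rewrite /mdist/= /sepquot_dist -raddfB sepquot_norm_pi.
apply: (@le_trans _ _ (\sum_(i < k.+1) ('N_p (derive1n i (f - g))) `^ p)).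
  rewrite big_ord_recl lerDl; apply: sumr_ge0 => i _; exact: powR_ge0.
exact: (eq_ind _ (fun y => y <= sobolev_norm k (f - g) `^ p) (lexx _) _
  (sobolev_normpE k (f - g))).
Qed.

Lemma alpha_pi k (u : cauchyseq (sobolev_qnorm k)) :
  alpha (\pi_(sobolev k) u) = limn (fun j => \pi_LpI (Lp_of_testfun (u j))).
Proof.
set v := repr (\pi_(sobolev k) u).
have vu : sobolev_qnorm k (v j - u j) @[j --> \oo] --> 0.
  by apply/(completionP (N := sobolev_qnorm k)); rewrite reprK.
have vup := powR_cvg (p_gt0 p01) (fun j => sobolev_norm_ge0 k (v j - u j)) vu.
rewrite powR0 ?(p_neq0 p01)// in vup.
pose b (w : nat -> testfun R) j := \pi_LpI (Lp_of_testfun (w j)).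
have key (w z : nat -> testfun R) (l : LpI) :
    mdist (b w j) (b z j) @[j --> \oo] --> (0 : R) ->
    b w @ \oo --> l -> b z @ \oo --> l.
  move=> wz /metricType_numDomainType.cvgrPdist_lt wl.
  apply/metricType_numDomainType.cvgrPdist_lt => e e0.
  have e20 : 0 < e / 2 by rewrite divr_gt0.
  move/cvgrPdist_lt : wz => /(_ _ e20) wz; have {}wl := wl _ e20.
  near=> j; rewrite (splitr e) (le_lt_trans (metric_triangle _ (b w j) _))//.
  rewrite ltrD//; first by near: j.
  rewrite (le_lt_trans (ler_norm _))// -normrN -sub0r.
  by near: j.
have vz : mdist (b v j) (b u j) @[j --> \oo] --> (0 : R).
  apply: (squeeze_cvgr _ (cvg_cst 0) vup); apply: nearW => j.
  by rewrite mdist_ge0/= LpI_dist_le.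
rewrite /alpha -/v /lim /lim_in; congr (get _).
apply/funext => l; apply/propext; split; apply: key => //.
by under eq_fun do rewrite metric_sym.
Unshelve. all: by end_near. Qed.

End sobolev.

(* Main.v *)
Require Import Defs.
From HB Require Import structures.
From mathcomp Require Import all_boot all_order all_algebra.
From mathcomp Require Import all_classical all_reals all_analysis.
From mathcomp Require Import measurable_realfun.
From mathcomp Require Import lra ring.

Import Order.TTheory GRing.Theory Num.Theory.
Import numFieldNormedType.Exports.

Local Open Scope classical_set_scope.
Local Open Scope ring_scope.

(** The pair (alpha, delta) identifies W^{k+1,p} with the product of L^p and
    W^{k,p}: since ||f||_{k+1}^p = ||f||_p^p + ||f'||_k^p, it is injective, and
    the theorem is the surjectivity of its second component together with the
    description of its kernel by beta.

    Kernel. If delta w = 0, then w and beta (alpha w) have the same image under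
    alpha and under delta, hence are equal (alpha_delta_injective). That alpha
    is a genuine limit rests on the completeness of L^p for p < 1 (Lp_complete),
    proved by extracting a rapidly convergent subsequence and applying Fatou's
    lemma.

    Surjectivity. The derivatives of test functions are dense in W^{k,p}
    (derive_dense). A test function g is the derivative of a test function
    exactly when its integral vanishes, so it suffices to subtract from g a
    multiple of a test function of integral 1 whose derivatives of order at
    most k are all small in L^p. Such functions are the derivatives of the
    steep transitions from 0 to 1 built in transition_small, by averaging over
    short intervals: averaging V over intervals of length h replaces V' by the
    difference quotient (V(x) - V(x-h))/h, which is bounded by 2C/h on a set of
    length O(h), hence small in L^p because p < 1, while the derivative of
    order i+1 of the average is controlled by the derivative of order i of V,
    already made small by induction when i > 0. Given F' close to g,
    subtracting from F an approximation of beta (F) makes F small in L^p and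
    barely changes F' (graph_dense). Doing so along a Cauchy sequence g_j
    produces f_j tending to 0 in L^p with f_j' - g_j tending to 0 in W^{k,p},
    so (f_j) is Cauchy in W^{k+1,p} and is mapped by delta to the class of
    (g_j). *)

(** * Smooth functions and transitions from 0 to 1 *)

Section smooth_functions.
Context (R : realType).
Implicit Types f g F V : R -> R.

(** The vanishing of f on a left half-line makes it integrable on every
    ]-oo, u], so that one integral from -oo is a primitive on the whole line. *)
Lemma primitive_exists {f} (a : R) : continuous f ->
  (forall x, x < a -> f x = 0) ->
  exists F, forall x : R, is_derive x 1 F (f x).
Proof.
move=> cf f0.
have mf : measurable_fun setT (f : measurableTypeR R -> measurableTypeR R).
  exact: continuous_measurable_fun.
have fi (u : R) : (@lebesgue_measure R).-integrable
    [set` Interval -oo%O (BRight u)] (EFin \o f).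
  have mI : measurable ([set` Interval -oo%O (BRight u)] : set (measurableTypeR R)).
    exact: measurable_itv.
  have K : (@lebesgue_measure R).-integrable `[a, u]%classic (EFin \o f).
    apply: continuous_compact_integrable; first exact: segment_compact.
    exact: continuous_subspaceT.
  apply/integrableP; split.
    by apply/measurable_EFinP; exact: measurable_funS mf.
  move/integrableP : K => [_]; apply: le_lt_trans.
  rewrite integral_mkcond [leRHS]integral_mkcond.
  rewrite le_eqVlt; apply/orP; left; apply/eqP; apply: eq_integral => x _.
  rewrite !patchE; case: ifPn => xu; case: ifPn => xau //=.
  - rewrite f0 ?normr0// ltNge; apply/negP => ax.
    by move/negP : xau; apply; move: xu; rewrite !inE/= !in_itv/= => ->; rewrite ax.
  - move: xau xu; rewrite inE/= in_itv/= => /andP[_ xu].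
    by rewrite notin_setE/= in_itv/= xu.
pose F x := (\int[lebesgue_measure]_(t in [set` Interval -oo%O (BRight x)]) f t)%R.
exists F => x.
have xx1 : x < x + 1 by rewrite ltrDl.
have [|] := @continuous_FTC1 _ f -oo%O x (x + 1) xx1 (fi _) _ (cf x).
  by rewrite ltNyr.
by move=> dF <-; rewrite derive1E; exact: DeriveDef.
Qed.

Lemma mean_value {f F} (x y : R) : (forall z : R, is_derive z 1 F (f z)) ->
  x < y -> exists2 z, x < z < y & F y - F x = f z * (y - x).
Proof.
move=> Ff xy; have [] := @MVT _ F f x y xy (fun z _ => Ff z).
  apply: continuous_subspaceT => z; apply: differentiable_continuous.
  by apply/derivable1_diffP; have [] := Ff z.
by move=> z; rewrite in_itv/= => zxy ->; exists z.
Qed.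

Lemma is_derive_derive1 {f F} : (forall z : R, is_derive z 1 F (f z)) ->
  F^`()%classic = f.
Proof. by move=> Ff; apply/funext => x; rewrite derive1E derive_val. Qed.

Lemma smooth_primitive {f F} : (forall z : R, is_derive z 1 F (f z)) ->
  smooth f -> smooth F.
Proof.
move=> Ff sf [|n] x; first by have [] := Ff x.
by rewrite derive1nE (is_derive_derive1 Ff).
Qed.

Lemma smooth_derive1 f : smooth f -> smooth f^`()%classic.
Proof. by move=> sf n x; rewrite -derive1nE; exact: sf. Qed.

Lemma smooth_continuous f : smooth f -> continuous f.
Proof.
move=> sf x; apply: differentiable_continuous; apply/derivable1_diffP.
exact: (sf 0%N x).
Qed.

Lemma smoothD f g (c : R) : smooth f -> smooth g -> smooth (c *: f + g).
Proof.
by move=> sf sg n x; rewrite derive1nD//; apply: derivableD => //; exact: derivableZ.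
Qed.

Lemma is_derive_affine f df (c d x : R) :
  (forall z : R, is_derive z 1 f (df z)) ->
  is_derive x 1 (fun x => f (c * x + d)) (c * df (c * x + d)).
Proof.
move=> fdf; rewrite mulrC; apply: (is_derive1_comp (fdf _)).
by apply: is_derive_eq; rewrite addr0 /GRing.scale /= mulr1.
Qed.

Lemma derive1n_is_derive {f} n (x : R) : smooth f ->
  is_derive x 1 (derive1n n f) (derive1n n.+1 f x).
Proof. by move=> sf; rewrite derive1nS derive1E; apply/derivableP; exact: sf. Qed.

Lemma derive1n_affine {f} (c d : R) n : smooth f ->
  derive1n n (fun x => f (c * x + d)) =
  fun x => c ^+ n * derive1n n f (c * x + d).
Proof.
move=> sf; elim: n => [|n ih]; first by apply/funext => x; rewrite expr0 mul1r.
rewrite derive1nS ih; apply: is_derive_derive1 => x.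
have := is_derive_affine _ _ c d x (fun z => derive1n_is_derive n z sf).
move=> h; apply: (is_derive_eq (is_deriveZ (c ^+ n) h)).
by rewrite exprSr -mulrA.
Qed.

Lemma smooth_affine f (c d : R) : smooth f -> smooth (fun x => f (c * x + d)).
Proof.
move=> sf n x; rewrite derive1n_affine//; apply: derivableM.
  exact: derivable_cst.
by have [] := is_derive_affine _ _ c d x (fun z => derive1n_is_derive n z sf).
Qed.

Definition backward_quotient (h : R) f : R -> R :=
  fun x => h^-1 * (f x - f (x - h)).

Let backward_quotientE h f :
  backward_quotient h f = h^-1 *: ((-1) *: (fun x => f (1 * x - h)) + f).
Proof.
apply/funext => x; rewrite -[RHS]/(h^-1 * (-1 * f (1 * x - h) + f x)).
by rewrite mulN1r mul1r addrC.
Qed.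

(** Differentiation commutes with translations, hence with the quotient. *)
Lemma derive1n_backward_quotient h f n : smooth f ->
  derive1n n (backward_quotient h f) = backward_quotient h (derive1n n f).
Proof.
move=> sf; have sfh := smooth_affine f 1 (- h) sf.
rewrite !backward_quotientE derive1nZE; last exact: smoothD.
rewrite derive1nD// derive1n_affine// expr1n.
by congr (_ *: (_ *: _ + _)); apply/funext => x; rewrite mul1r.
Qed.

Lemma smooth_backward_quotient h f : smooth f -> smooth (backward_quotient h f).
Proof.
move=> sf n x; rewrite derive1n_backward_quotient//.
rewrite (_ : backward_quotient _ _ =
    (fun x => h^-1 * (derive1n n f x - derive1n n f (1 * x - h)))).
  apply: derivableM; first exact: derivable_cst.
  apply: derivableB; first exact: sf.
  by have [] := is_derive_affine _ _ 1 (- h) x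
    (fun z => derive1n_is_derive n z sf).
by apply/funext => y; rewrite mul1r.
Qed.

Lemma testpred_bounded_support f (a b : R) : smooth f ->
  (forall x, x < a -> f x = 0) -> (forall x, b < x -> f x = 0) ->
  f \in @testpred R.
Proof.
move=> sf fa fb; rewrite inE; split => //.
apply: (@subclosed_compact _ _ `[a, b]%classic); first exact: closed_closure.
  exact: segment_compact.
rewrite [X in _ `<=` X](iffLR (closure_id _) (@itv_closed _ R a b)).
apply: closure_subset => x /= fx; rewrite in_itv/= !leNgt.
by apply/andP; split; apply: contra_neqN fx; [exact: fa|exact: fb].
Qed.

(** V is the primitive of a function of integral 1 supported in [0, r]; the
    uniform bound C on V replaces an L^1 bound on V', and survives averaging. *)
Definition transition (C r : R) V := [/\ smooth V,
  forall x : R, x <= 0 -> V x = 0, forall x, r <= x -> V x = 1 &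
  forall x, `|V x| <= C].

(** W(x) is the mean of V over [x - h, x]. By the mean value theorem W(x) is a
    value of V in that interval, which gives all the bounds on W at once. *)
Lemma transition_average (C r h : R) V : 0 < h -> transition C r V ->
  exists2 W, transition C (r + h) W &
    W^`()%classic = backward_quotient h V.
Proof.
move=> h0 [sV V0 V1 VC].
have [|U UV] := primitive_exists 0 (smooth_continuous V sV).
  by move=> x /ltW; exact: V0.
pose W x := h^-1 * (U x - U (x - h)).
have Wd (x : R) : is_derive x 1 W (backward_quotient h V x).
  have dh : is_derive x 1 (fun x => U (x - h)) (V (x - h)).
    have := is_derive_affine U V 1 (- h) x UV; rewrite !mul1r.
    by under [X in is_derive _ _ X]eq_fun do rewrite mul1r.
  exact: is_deriveZ.
have mean (x : R) : exists2 z, x - h < z < x & W x = V z.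
  have [|z zx Uz] := mean_value (x - h) x UV; first by rewrite ltrBlDr ltrDl.
  exists z => //; rewrite /W Uz opprB [x + _]addrC subrK mulrCA mulVf ?mulr1//.
  by rewrite gt_eqF.
exists W; last exact: is_derive_derive1.
split.
- exact: (smooth_primitive Wd (smooth_backward_quotient h V sV)).
- by move=> x x0; have [z /andP[_ /ltW zx] ->] := mean x; rewrite V0// (le_trans zx).
- move=> x; rewrite -lerBrDr => rx.
  by have [z /andP[/ltW xz _] ->] := mean x; rewrite V1// (le_trans rx).
- by move=> x; have [z _ ->] := mean x.
Qed.

(** V is locally constant outside [0, r]. *)
Lemma transition_derive_support (C r : R) V : transition C r V ->
  (forall x : R, x < 0 -> V^`()%classic x = 0) /\
  (forall x, r < x -> V^`()%classic x = 0).
Proof.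
move=> [_ V0 V1 _]; split=> x xr; rewrite derive1E.
  rewrite (@near_eq_derive _ _ _ V (cst 0) x 1) ?derive_cst//.
  by near=> y; apply: V0; apply/ltW; near: y; exact: lt_nbhsl.
rewrite (@near_eq_derive _ _ _ V (cst 1) x 1) ?derive_cst//.
by near=> y; apply: V1; apply/ltW; near: y; exact: lt_nbhsr.
Unshelve. all: by end_near. Qed.

Lemma transition_testpred (C r : R) V n (t : R) : transition C r V ->
  (fun x => derive1n n.+1 V (x + t)) \in @testpred R.
Proof.
move=> TV; have [sV _ _ _] := TV.
have -> : (fun x => derive1n n.+1 V (x + t)) =
    derive1n n (fun x => V^`()%classic (1 * x + t)).
  rewrite derive1n_affine; last exact: smooth_derive1.
  by apply/funext => x; rewrite expr1n mul1r derive1nE mul1r.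
have [N0 N1] := transition_derive_support _ _ _ TV.
apply: testpred_derive1n; apply: (testpred_bounded_support _ (- t) (r - t)).
- by apply: smooth_affine; exact: smooth_derive1.
- by move=> x xt; rewrite N0// mul1r -ltrBrDr sub0r.
- by move=> x xt; rewrite N1// mul1r -ltrBlDr.
Qed.

Lemma transition_wider {C r r' : R} {V} : r <= r' -> transition C r V ->
  transition C r' V.
Proof.
by move=> rr' [sV V0 V1 VC]; split => // x r'x; exact/V1/(le_trans rr').
Qed.

End smooth_functions.

(** * Density of derivatives in the Sobolev spaces *)

Lemma transition_rescale {R : realType} {C r h : R} {V : R -> R} : 0 < r -> 0 < h ->
  transition R C r V -> transition R C h (fun x => V (r / h * x + 0)).
Proof.
move=> r0 h0 [sV V0 V1 VC].
have rh : 0 < r / h by rewrite divr_gt0.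
split.
- exact: smooth_affine.
- by move=> x x0; rewrite V0// addr0 pmulr_rle0.
- by move=> x hx; rewrite V1// addr0 mulrAC ler_pdivlMr// ler_pM2l.
- by move=> x; exact: VC.
Qed.

Section small_derivatives.
Context (R : realType) (I : interval R) (p : R) (p01 : 0 < p < 1).

Local Notation Np f := (Lp_norm (lebesgue_on I) p f).

Lemma test_Lp (f : R -> R) : f \in @testpred R ->
  (f : measurableTypeR R -> R) \in Lppred (lebesgue_on I) p01.
Proof. by move=> tf; exact: (testfun_Lppred I p01 (TestFun tf)). Qed.

Lemma Lp_norm_bounded_support (f : R -> R) (M a b : R) :
  f \in @testpred R -> a <= b ->
  (forall x, `|f x| <= M) -> (forall x, x < a -> f x = 0) ->
  (forall x, b < x -> f x = 0) -> Np f `^ p <= M `^ p * (b - a).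
Proof.
move=> tf ab fM fa fb; rewrite (Lp_normpE _ p01) -[leRHS]/(fine (_%:E)).
have p0 := p_gt0 p01.
apply: fine_le => //; first exact/Lppred_fin_num/test_Lp.
have /(Lfun_ltP _ p01)[mf _] := test_Lp _ tf.
pose D := `[a, b]%classic.
have mD : measurable (D : set (measurableTypeR R)) by exact: measurable_itv.
apply: (@le_trans _ _ (\int[lebesgue_on I]_x ((M `^ p)%:E * (\1_D x)%:E))%E).
  apply: ge0_le_integral => //.
  - apply/measurable_EFinP; apply: (measurableT_comp (measurable_powR p)).
    exact: measurableT_comp.
  - apply/measurable_EFinP; apply: measurable_funM => //.
  - move=> x _; rewrite -EFinM lee_fin indicE.
    have [xD|] := boolP (x \in D).
      rewrite mulr1; apply: ge0_ler_powR; rewrite ?nnegrE ?(ltW p0)//.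
      by rewrite (le_trans _ (fM 0)).
    rewrite notin_setE /D/= in_itv/= => /negP; rewrite negb_and -!ltNge => xD.
    have -> : f x = 0 by case/orP: xD => [/fa|/fb].
    by rewrite normr0 powR0 ?mulr0// gt_eqF.
rewrite ge0_integralZl ?lee_fin ?powR_ge0//; last first.
  exact/measurable_EFinP.
rewrite integral_indic// setIT EFinM lee_wpmul2l ?lee_fin ?powR_ge0//.
apply: (@le_trans _ _ (lebesgue_measure D)).
  by apply: le_measure; rewrite ?inE//; exact: measurableI.
by rewrite lebesgue_measure_itv/= lte_fin; case: ifP => //; rewrite lee_fin subr_ge0.
Qed.

Lemma Lp_normZp (c : R) (f : R -> R) : f \in @testpred R ->
  Np (c *: f) `^ p = `|c| `^ p * Np f `^ p.
Proof.
by move=> tf; rewrite (Lp_normZ _ (test_Lp _ tf)) powRM// Lp_norm_ge0.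
Qed.

Lemma Lp_normBp (f g : R -> R) : f \in @testpred R -> g \in @testpred R ->
  Np (f - g) `^ p <= Np f `^ p + Np g `^ p.
Proof.
move=> tf tg.
have -> : Np g `^ p = Np (- g) `^ p.
  by rewrite -scaleN1r Lp_normZp// normrN normr1 powR1 mul1r.
by apply: Lp_normD; apply: test_Lp; rewrite ?rpredN.
Qed.

(** This is where p < 1 enters: a function of size c / h on an interval of
    length h + h has a p-th power integral of order h^(1-p). *)
Lemma small_width (c r : R) : 0 <= c -> 0 < r -> forall e, 0 < e ->
  exists2 h, 0 < h <= r & (c / h) `^ p * (h + h) < e.
Proof.
move=> c0 r0 e e0; have [p0 p1] := andP p01.
have q0 : 0 < 1 - p by rewrite subr_gt0.
have qN0 : 1 - p != 0 by rewrite gt_eqF.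
pose d := e / (2 * (c `^ p + 1)).
have d0 : 0 < d by rewrite divr_gt0// mulr_gt0// ltr_wpDl ?powR_ge0.
pose h := Num.min r (d `^ (1 - p)^-1).
have h0 : 0 < h by rewrite lt_min r0 powR_gt0.
exists h; first by rewrite h0 ge_min lexx.
have hd : h `^ (1 - p) <= d.
  rewrite -[leRHS](@powRKV _ (1 - p))//; last exact: ltW.
  apply: ge0_ler_powR; rewrite ?nnegrE ?powR_ge0 ?(ltW h0) ?(ltW q0)//.
  by rewrite ge_min lexx orbT.
have -> : (c / h) `^ p * (h + h) = 2 * c `^ p * h `^ (1 - p).
  rewrite powRM ?invr_ge0 ?(ltW h0)// -powR_inv1 ?(ltW h0)// -powRrM mulN1r.
  rewrite powRD; last by rewrite (gt_eqF h0) implybT.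
  rewrite powRr1 ?(ltW h0)// -mulr2n -mulr_natl; ring.
apply: (le_lt_trans (ler_wpM2l _ hd)); first by rewrite mulr_ge0// powR_ge0.
rewrite /d mulrCA gtr_pMr// ltr_pdivrMr ?mul1r; last first.
  by rewrite mulr_gt0// ltr_wpDl ?powR_ge0.
by rewrite ltr_pM2l// ltrDl.
Qed.

(** One averaging step per derivative. The bound is required for all translates
    because the norm of L^p(I) is not translation invariant, while the step
    involves the function and its translate by h. *)
Lemma transition_small {C : R} n :
  (forall r : R, 0 < r -> exists V, transition R C r V) ->
  forall e r : R, 0 < e -> 0 < r -> exists2 V, transition R C r V &
  forall i t, (i < n)%N -> Np (fun x => derive1n i.+1 V (x + t)) `^ p < e.
Proof.
move=> exV; elim: n => [|n ih] e r e0 r0.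
  by have [V TV] := exV _ r0; exists V.
have C0 : 0 <= C.
  by have [V [_ _ _ VC]] := exV _ r0; exact: le_trans (VC 0).
have p0 := p_gt0 p01.
(* The first derivative of the average is at most 2C/h on an interval of
   length 2h, so that the width h can be chosen before V. *)
have [|h /andP[h0 hr] he] :=
    small_width (2 * C) (r / 2) (mulr_ge0 (ler0n _ _) C0) _ _ e0.
  by rewrite divr_gt0.
(* The factor h^p / 2 offsets the division by h of a sum of two terms. *)
have e'0 : 0 < e * h `^ p / 2 by rewrite divr_gt0// mulr_gt0// powR_gt0.
have [V TV Ve] := ih _ _ e'0 h0.
have [W TW dW] := transition_average _ _ _ _ _ h0 TV.
have [sV _ _ VC] := TV.
exists W; first by apply: transition_wider TW; rewrite (splitr r) lerD.
have dnW i t x : derive1n i.+1 W (x + t) =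
    backward_quotient _ h (derive1n i V) (x + t).
  by rewrite derive1nE dW derive1n_backward_quotient.
move=> [|i] t.
  move=> _; apply: le_lt_trans he.
  have -> : h + h = (h + h - t) - (- t) by rewrite opprK subrK.
  have [W0 W1] := transition_derive_support _ _ _ _ TW.
  apply: Lp_norm_bounded_support.
  - exact: transition_testpred TW.
  - by rewrite lerBrDr addNr addr_ge0// ltW.
  - move=> x; rewrite dnW /backward_quotient normrM mulrC.
    rewrite (gtr0_norm (x := h^-1)) ?invr_gt0//.
    rewrite ler_wpM2r ?invr_ge0 ?(ltW h0)//.
    by rewrite (le_trans (ler_normB _ _))// mulr2n mulrDl mul1r lerD.
  - by move=> x xt; rewrite derive1n1 W0// -ltrBrDr sub0r.
  - by move=> x xt; rewrite derive1n1 W1// -ltrBlDr.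
rewrite ltnS => ni.
pose A s := (fun x => derive1n i.+1 V (x + s)).
have tA s : A s \in @testpred R by exact: transition_testpred TV.
have -> : (fun x => derive1n i.+2 W (x + t)) = h^-1 *: (A t - A (t - h)).
  by apply/funext => x; rewrite dnW /backward_quotient -[x + t - h]addrA.
rewrite Lp_normZp; last exact: rpredB.
have hp0 : 0 < `|h^-1| `^ p by rewrite powR_gt0// normr_gt0 invr_eq0 gt_eqF.
have AA : Np (A t - A (t - h)) `^ p < e * h `^ p.
  apply: (le_lt_trans (Lp_normBp _ _ (tA _) (tA _))).
  by rewrite [ltRHS]splitr ltrD ?Ve.
apply: (@lt_le_trans _ _ (`|h^-1| `^ p * (e * h `^ p))).
  by rewrite ltr_pM2l.
rewrite gtr0_norm ?invr_gt0// mulrCA -powRM ?invr_ge0 ?(ltW h0)//.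
by rewrite mulVf ?gt_eqF// powR1 mulr1.
Qed.

(** The value G M is the total integral of g. *)
Lemma testfun_primitive (g : testfun R) : exists2 M : R, 0 <= M &
  exists G : R -> R, [/\ forall x : R, is_derive x 1 G (g x),
  forall x : R, x <= - M -> G x = 0, forall x, M <= x -> G x = G M &
  exists C, forall x, `|G x| <= C].
Proof.
have [M [gM g0]] := testfun_bounded g.
have M0 : 0 <= M by exact: le_trans (gM 0).
have gl x : x < - M -> g x = 0.
  move=> xM; apply: g0; have x0 : x < 0.
    by apply: (lt_le_trans xM); rewrite oppr_le0.
  by rewrite ltr0_norm// ltrNr.
have gr x : M < x -> g x = 0.
  by move=> xM; apply: g0; rewrite gtr0_norm// (le_lt_trans M0).
have cg : continuous g by exact: testfun_continuous.
have [G1 G1g] := primitive_exists R (- M) cg gl.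
pose G x := G1 x - G1 (- M).
have Gg (x : R) : is_derive x 1 G (g x).
  by apply: is_derive_eq; rewrite subr0.
have Gl x : x <= - M -> G x = 0.
  rewrite le_eqVlt => /predU1P[->|xM]; first by rewrite /G subrr.
  have [z /andP[_ zM] h] := mean_value R _ _ G1g xM.
  by apply/eqP; rewrite -oppr_eq0 /G opprB h gl// mul0r.
have Gr x : M <= x -> G x = G M.
  rewrite le_eqVlt => /predU1P[->//|xM].
  have [z /andP[zM _] h] := mean_value R _ _ Gg xM.
  by apply/eqP; rewrite -subr_eq0 h gr// mul0r.
have MG x : x <= M -> `|G x| <= M * (M + M).
  move=> xM; have [xNM|xNM] := leP x (- M).
    by rewrite Gl// normr0 mulr_ge0// addr_ge0.
  have [z _] := mean_value R _ _ Gg xNM.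
  rewrite [G (- M)]Gl// subr0 => ->; rewrite normrM ler_pM// opprK.
  by rewrite ger0_norm ?lerD2r// -lerBlDr sub0r ltW.
exists M => //; exists G; split => //; exists (M * (M + M)) => x.
by have [/MG//|/ltW/Gr ->] := leP x M; exact: MG.
Qed.

(** The correction G - G(M) V of the primitive G of g by a steep transition V
    has compact support, and its derivative differs from g by a multiple of V',
    which is small. When G(M) is not 0, the rescaled primitive G / G(M) is
    itself the transition from which the steep ones are built, so no particular
    bump function is needed. *)
Lemma derive_dense (k : nat) (g : testfun R) (e : R) : 0 < e ->
  exists F : testfun R, sobolev_norm I p k (testfun_derive F - g) `^ p < e.
Proof.
move=> e0; have p0 := p_gt0 p01.
have [M M0 [G [Gg Gl Gr [C GC]]]] := testfun_primitive g.
have sG := smooth_primitive _ Gg (@testfun_smooth _ g).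
suff [V [sV V0 V1 Vk]] : exists V : R -> R, [/\ smooth V,
    forall x, x <= 0 -> V x = 0, forall x, 1 <= x -> G M * V x = G M &
    forall i, (i < k.+1)%N ->
      Np ((- G M) *: derive1n i.+1 V) `^ p < e / k.+1%:R / 2].
  have tF : (- G M) *: V + G \in @testpred R.
    apply: (testpred_bounded_support _ _ (- M) (M + 1)).
    - exact: smoothD.
    - move=> x xM; rewrite -[LHS]/(- G M * V x + G x).
      have x0 : x < 0 by apply: (lt_le_trans xM); rewrite oppr_le0.
      by rewrite (Gl x) ?(ltW xM)// V0 ?(ltW x0)// mulr0 addr0.
    - move=> x xM; rewrite -[LHS]/(- G M * V x + G x).
      have [Mx x1] : M < x /\ 1 < x.
        by split; apply: le_lt_trans xM; rewrite ?lerDl ?lerDr.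
      by rewrite mulNr V1 ?(ltW x1)// (Gr x) ?(ltW Mx)// addNr.
  exists (TestFun tF); rewrite sobolev_normpE//.
  have dF i : derive1n i (testfun_derive (TestFun tF) - g : testfun R) =
      (- G M) *: derive1n i.+1 V.
    rewrite derive1nE -derive1nZE; last exact: smooth_derive1.
    congr (derive1n i _); apply/funext => x.
    rewrite -[LHS]/(derive1n 1 ((- G M) *: V + G) x - g x) derive1nD//.
    rewrite [derive1n 1 G](is_derive_derive1 _ Gg).
    by rewrite -[LHS]/(- G M * derive1n 1 V x + g x - g x) addrK.
  apply: (@le_lt_trans _ _ (\sum_(i < k.+1) (e / k.+1%:R / 2))).
    by apply: ler_sum => i _; rewrite dF ltW// Vk.
  rewrite sumr_const card_ord -mulrnAl -[_ *+ _]mulr_natr divfK ?pnatr_eq0//.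
  by rewrite ltr_pdivrMr// ltr_pMr// ltr1n.
have e1 : 0 < e / k.+1%:R / 2 by rewrite !divr_gt0.
(* If the integral of g vanishes, G itself is a test function. *)
have [GM0|GM0] := eqVneq (G M) 0.
  exists 0; split => //; first exact: smooth0.
    by move=> x _; rewrite GM0 mul0r.
  move=> i _; rewrite GM0 oppr0 scale0r /= (_ : Np 0 = 0) ?powR0 ?gt_eqF//.
  by have := qn0 (Lp_qnorm (lebesgue_on I) p01).
have T0 : transition R (`|(G M)^-1| * C) (M + M + 1)
    (fun x => (G M)^-1 * G (1 * x - M)).
  split.
  - have := smoothD _ _ _ (G M)^-1 (smooth_affine _ G 1 (- M) sG) (@smooth0 R).
    by rewrite addr0.
  - by move=> x x0; rewrite (Gl (1 * x - M)) ?mulr0// mul1r lerBlDr addNr.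
  - move=> x xM; rewrite (Gr (1 * x - M)) ?mulVf// mul1r lerBrDr.
    by apply: le_trans xM; rewrite lerDl.
  - by move=> x; rewrite normrM ler_wpM2l.
have M1 : 0 < M + M + 1 by rewrite ltr_wpDl// addr_ge0.
have exV (r : R) : 0 < r -> exists V, transition R (`|(G M)^-1| * C) r V.
  by move=> r0; eexists; exact: (transition_rescale M1 r0 T0).
have GMp : 0 < `|G M| `^ p by rewrite powR_gt0// normr_gt0.
have [|V TV Ve] := transition_small k.+1 exV
  (e / k.+1%:R / 2 / `|G M| `^ p) 1 _ ltr01.
  by rewrite divr_gt0.
have [sV V0 V1 _] := TV; exists V; split => //.
  by move=> x /V1 ->; rewrite mulr1.
move=> i ik.
have tV := transition_testpred _ _ _ _ i 0 TV.
have VE : (fun x => derive1n i.+1 V (x + 0)) = derive1n i.+1 V.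
  by apply/funext => x; rewrite addr0.
rewrite VE in tV.
rewrite Lp_normZp// normrN mulrC -ltr_pdivlMr//.
by have := Ve i 0 ik; rewrite VE.
Qed.
End small_derivatives.

(** * Completeness of L^p for p < 1 *)

Section Lp_complete.
Context d (T : measurableType d) (R : realType).
Variable mu : {measure set T -> \bar R}.
Context (p : R) (p01 : 0 < p < 1).

Local Notation Np f := (Lp_norm mu p f).

Lemma Lp_measurable (u : Lpfun mu p01) : measurable_fun setT u.
Proof. by have /(Lfun_ltP _ p01)[] := Lpfun_valP u. Qed.

Lemma measurable_normp (f : T -> R) : measurable_fun setT f ->
  measurable_fun setT (fun x => (`|f x| `^ p)%:E).
Proof.
move=> mf; apply/measurable_EFinP.
by apply: (measurableT_comp (measurable_powR p)); exact: measurableT_comp.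
Qed.

Lemma Lp_normpEFin (u : Lpfun mu p01) :
  (Np u `^ p)%:E = (\int[mu]_x (`|u x| `^ p)%:E)%E.
Proof.
by rewrite (Lp_normpE mu p01) fineK// (Lppred_fin_num (Lpfun_valP u)).
Qed.

(** Subadditivity of the p-th power makes |x - y|^p a distance on the line, so
    that the usual telescoping argument applies to it. *)
Lemma cvgn_summable_powR (v : nat -> R) :
  (\sum_(0 <= k <oo) (`|v k.+1 - v k| `^ p)%:E < +oo)%E -> cvgn v.
Proof.
set a := fun k => (`|v k.+1 - v k| `^ p)%:E => aoo.
have a0 k : (0 <= a k)%E by rewrite lee_fin powR_ge0.
have p0 := p_gt0 p01.
pose S n := \sum_(0 <= k < n) `|v k.+1 - v k| `^ p.
have Sa n : (S n)%:E = (\sum_(0 <= k < n) a k)%E by rewrite -sumEFin.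
pose L := fine (\sum_(0 <= k <oo) a k).
have LE : (L%:E = \sum_(0 <= k <oo) a k)%E.
  by rewrite fineK// ge0_fin_numE// nneseries_ge0.
have SL n : S n <= L.
  by rewrite -lee_fin LE Sa; exact: nneseries_lim_ge.
have cS : S @ \oo --> L.
  have cG : cvgn (fun n => \sum_(0 <= k < n) a k)%E.
    by apply: is_cvg_nneseries => k _ _; exact: a0.
  have : (fun n => (S n)%:E) @ \oo --> L%:E.
    have /funext -> := Sa.
    by rewrite LE; exact: cG.
  by move=> /fine_cvg.
have vS n m : `|v (n + m)%N - v n| `^ p <= S (n + m)%N - S n.
  elim: m => [|m ih]; first by rewrite addn0 !subrr normr0 powR0// gt_eqF.
  rewrite addnS /S big_nat_recr//= addrAC.
  apply: le_trans (lerD ih (lexx _)).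
  apply: le_trans (powR_subadd p01 (normr_ge0 _) (normr_ge0 _)).
  apply: ge0_ler_powR; rewrite ?nnegrE ?addr_ge0// ?(ltW p0)//.
  by rewrite (le_trans (ler_distD (v (n + m)%N) _ _))// addrC.
apply: cauchy_cvg; apply: cauchy_exP => e e0.
have ep0 : 0 < e `^ p by rewrite powR_gt0.
move/cvgrPdist_lt : cS => /(_ _ ep0)[n0 _ h].
exists (v n0), n0 => // n /= nn.
rewrite /ball/= distrC -(powR_lt_iff p0) ?(ltW e0)//.
rewrite -(subnKC nn) (le_lt_trans (vS _ _))//.
have := h n0 (leqnn _); rewrite /= ger0_norm ?subr_ge0//.
by apply: le_lt_trans; rewrite lerB// SL.
Qed.

(** The sum of the |v_{k+1} - v_k|^p has a finite integral, hence is finite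
    almost everywhere; D is the set where it is finite. *)
Lemma fast_Lp_cvg_ae (v : nat -> Lpfun mu p01) :
  (forall k, Np (v k.+1 - v k) `^ p <= (1 / 2) ^+ k) ->
  exists2 D, measurable D /\ mu.-negligible (~` D) &
    forall x, D x -> cvgn (fun k => v k x).
Proof.
move=> fv.
pose a k x := (`|v k.+1 x - v k x| `^ p)%:E.
have ma k : measurable_fun setT (a k).
  by apply: measurable_normp; apply: measurable_funB; exact: Lp_measurable.
have a0 k x : (0 <= a k x)%E by rewrite lee_fin powR_ge0.
pose G x := (\sum_(0 <= k <oo) a k x)%E.
have mG : measurable_fun setT G.
  by apply: ge0_emeasurable_sum.
have iG : (\int[mu]_x G x < +oo)%E.
  rewrite integral_nneseries//.
  apply: (@le_lt_trans _ _ (\sum_(0 <= k <oo) ((1 / 2) ^+ k)%:E)%E).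
    apply: lee_nneseries => k _; first by move=> _; exact: integral_ge0.
    rewrite -[leLHS](Lp_normpEFin (v k.+1 - v k)) lee_fin; exact: fv.
  apply: (@le_lt_trans _ _ 2%:E); last exact: ltry.
  apply: lime_le.
    by apply: is_cvg_nneseries => k _ _; rewrite lee_fin exprn_ge0.
  apply: nearW => n; rewrite sumEFin lee_fin.
  have := @geometric_le_lim R n 1 (1 / 2) ler01.
  rewrite (ger0_norm (x := 1 / 2))// => /(_ _ _).
  rewrite (_ : 1 / (1 - 1 / 2) = 2); last by field.
  rewrite (_ : series _ n = \sum_(0 <= i < n) (1 / 2) ^+ i); last first.
    by rewrite /series/=; apply: eq_bigr => i _; rewrite /geometric/= !mul1r.
  by apply; lra.
exists [set x | (G x < +oo)%E]; first split.
- rewrite (_ : [set x | _] = ~` (setT `&` [set x | (+oo <= G x)%E])).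
    by apply: measurableC; exact: emeasurable_fun_c_infty.
  by rewrite setTI; apply/seteqP; split => x /=; rewrite ltNge => /negP.
- have : mu.-integrable setT G.
    apply/integrableP; split => //.
    by under eq_integral do rewrite gee0_abs ?nneseries_ge0//.
  move=> /(integrable_ae measurableT); apply: negligibleS => x /= Gx h.
  by apply: Gx; rewrite -ge0_fin_numE ?nneseries_ge0// h.
- by move=> x /= Gx; exact: cvgn_summable_powR.
Qed.

(** The indices s k are non-decreasing but not necessarily increasing: only
    k <= s k matters for convergence. *)
Lemma cauchy_fast_subseq (u : nat -> Lpfun mu p01) :
  is_cauchy (Lp_qnorm mu p01) u -> exists s : nat -> nat,
  (forall k, (k <= s k)%N) /\
  (forall k, Np (u (s k.+1) - u (s k)) `^ p <= (1 / 2) ^+ k).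
Proof.
move=> /is_cauchyP uC.
have /choice[n0 hn0] : forall k, exists n0, forall m n, (n0 <= m)%N ->
    (n0 <= n)%N -> Np (u m - u n) `^ p < (1 / 2) ^+ k.
  by move=> k; apply: uC; rewrite exprn_gt0.
pose s k := \max_(i < k.+1) maxn (n0 i) i.
have sge k : (maxn (n0 k) k <= s k)%N.
  exact: (leq_bigmax_cond (F := fun i : 'I_k.+1 => maxn (n0 i) i) ord_max).
have sS k : (s k <= s k.+1)%N by rewrite /s [leqRHS]big_ord_recr leq_maxl.
exists s; split=> k; first by apply: leq_trans (sge k); exact: leq_maxr.
have ns : (n0 k <= s k)%N by apply: leq_trans (sge k); exact: leq_maxl.
by apply/ltW/hn0 => //; exact: leq_trans (sS k).
Qed.

Lemma Lp_complete (u : nat -> Lpfun mu p01) : is_cauchy (Lp_qnorm mu p01) u ->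
  exists l : Lpfun mu p01, forall e, 0 < e ->
  exists n0, forall n, (n0 <= n)%N -> Np (l - u n) `^ p <= e.
Proof.
move=> uC; have [s [ks fs]] := cauchy_fast_subseq _ uC.
have [D [mD nD] cD] := fast_Lp_cvg_ae (u \o s) fs.
(* Cutting off outside D makes the convergence hold everywhere, so that the
   limit is measurable, without changing any integral. *)
pose v k x := u (s k) x * \1_D x.
have mv k : measurable_fun setT (v k).
  by apply: measurable_funM; [exact: Lp_measurable|exact: measurable_indic].
pose f x := limn (fun k => v k x).
have vf x : v k x @[k --> \oo] --> f x.
  suff : cvgn (fun k => v k x) by [].
  have [xD|xD] := pselect (D x).
    have -> : (fun k => v k x) = (fun k => u (s k) x).
      by apply/funext => k; rewrite /v indicE mem_set// mulr1.
    exact: cD.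
  have -> : (fun k => v k x) = (fun=> 0).
    by apply/funext => k; rewrite /v indicE memNset// mulr0.
  exact: is_cvg_cst.
have mf : measurable_fun setT f.
  apply: (@measurable_fun_cvg _ T R setT v f); first exact: mv.
  by move=> x _; exact: vf.
have mfu n : measurable_fun setT (fun x => (`|f x - u n x| `^ p)%:E).
  apply: (measurable_normp (fun x => f x - u n x)).
  by apply: measurable_funB => //; exact: Lp_measurable.
have mvu k n : measurable_fun setT (fun x => (`|v k x - u n x| `^ p)%:E).
  apply: (measurable_normp (fun x => v k x - u n x)).
  by apply: measurable_funB => //; exact: Lp_measurable.
have p0 := p_gt0 p01.
have key e : 0 < e -> exists n0, forall n, (n0 <= n)%N ->
    (\int[mu]_x (`|f x - u n x| `^ p)%:E <= e%:E)%E.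
  move=> e0; have /is_cauchyP/(_ _ e0)[n0 hn0] := uC.
  exists n0 => n nn.
  pose g k x := (`|v k x - u n x| `^ p)%:E.
  have -> : (\int[mu]_x (`|f x - u n x| `^ p)%:E =
      \int[mu]_x limn_einf (g ^~ x))%E.
    apply: eq_integral => x _; apply/esym.
    suff /cvg_limn_einf_sup[-> //] : g k x @[k --> \oo] --> (`|f x - u n x| `^ p)%:E.
    apply: cvg_EFin; first exact: nearW.
    apply: powR_cvg => //; apply: cvg_norm; apply: cvgB; first exact: vf.
    exact: cvg_cst.
  (* The integrals of |v_k - u_n|^p are at most e for large k. *)
  apply: (@le_trans _ _ (limn_einf (fun k => \int[mu]_x g k x)%E)).
    apply: (fatou mu measurableT (f := g)); first by move=> k; exact: mvu.
    by move=> k x _; rewrite lee_fin powR_ge0.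
  rewrite limn_einf_lim; apply: lime_le; first exact: is_cvg_einfs.
  exists n0 => // k /= nk.
  apply: (@le_trans _ _ (\int[mu]_x g k x)%E).
    by apply: ereal_inf_lbound; exists k => /=.
  have -> : (\int[mu]_x g k x = (Np (u (s k) - u n) `^ p)%:E)%E.
    rewrite Lp_normpEFin; apply: ae_eq_integral => //; first exact: mvu.
      apply: (measurable_normp (u (s k) - u n : Lpfun mu p01)); exact: Lp_measurable.
    apply: negligibleS nD => x /= h xD; apply: h => _.
    by rewrite /g /v indicE mem_set// mulr1.
  by rewrite lee_fin ltW// hn0// (leq_trans nk).
have Lf : f \in Lppred mu p01.
  have [n0 /(_ _ (leqnn _)) h] := key 1 ltr01.
  have Lfu : (fun x => f x - u n0 x) \in Lppred mu p01.
    apply/(Lfun_ltP mu p01); split; last by apply: le_lt_trans h _; exact: ltry.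
    by apply: measurable_funB => //; exact: Lp_measurable.
  rewrite (_ : f = (fun x => f x - u n0 x) + (u n0 : T -> R)).
    by apply: rpredD => //; exact: Lpfun_valP.
  by apply/funext => x; rewrite -[RHS]/(f x - u n0 x + u n0 x) subrK.
exists (MkLpfun Lf) => e e0; have [n0 h] := key e e0; exists n0 => n nn.
by rewrite -lee_fin Lp_normpEFin; exact: h.
Qed.

End Lp_complete.

(** * The maps alpha and delta *)

(** Smallness is measured by p-th powers, which are subadditive. *)
Lemma qnorm_cvg0P {R : realType} {p : R} {p01 : 0 < p < 1} {V : lmodType R}
    (N : qnorm p01 V) (x : nat -> V) :
  N (x j) @[j --> \oo] --> 0 <->
  forall e, 0 < e -> exists n0, forall n, (n0 <= n)%N -> N (x n) `^ p <= e.
Proof.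
have p0 := p_gt0 p01; split=> [/(powR_cvg p0 (fun j => qn_ge0 N (x j))) + e e0|xe].
  rewrite powR0 ?gt_eqF// => /cvgrPdist_le/(_ _ e0)[n0 _ h].
  exists n0 => n /h; rewrite /= sub0r normrN ger0_norm//; exact: powR_ge0.
apply/cvgrPdist_le => e e0.
have [n0 h] := xe _ (powR_gt0 p e0); exists n0 => // n /= /h.
rewrite sub0r normrN (ger0_norm (qn_ge0 _ _)) leNgt (powR_lt_iff p0) ?qn_ge0//.
  by rewrite -leNgt.
exact: ltW.
Qed.

Lemma is_cauchy_cvg0 {R : realType} {p : R} {p01 : 0 < p < 1} {V : lmodType R}
    (N : qnorm p01 V) (x y : nat -> V) : is_cauchy N y ->
  N (x j - y j) @[j --> \oo] --> 0 -> is_cauchy N x.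
Proof.
move=> /is_cauchyP yC /qnorm_cvg0P xy; apply/is_cauchyP => e e0.
have e40 : 0 < e / 4 by rewrite divr_gt0.
have [n1 h1] := yC _ e40; have [n2 h2] := xy _ e40.
exists (maxn n1 n2) => m n; rewrite !geq_max => /andP[m1 m2] /andP[k1 k2].
have -> : x m - x n = (x m - y m) + (y m - y n) - (x n - y n).
  by rewrite opprB !addrA !subrK.
apply: (le_lt_trans (qnD N _ _)); rewrite qnN.
apply: (le_lt_trans (lerD (qnD N _ _) (lexx _))).
apply: (le_lt_trans (lerD (lerD (h2 m m2) (ltW (h1 m n m1 k1))) (h2 n k2))).
lra.
Qed.

Section sobolev_graph.
Local Open Scope quotient_scope.
Context (R : realType) (I : interval R) (p : R) (p01 : 0 < p < 1).

Local Notation Np f := (Lp_norm (lebesgue_on I) p f).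
Local Notation Lpq := (Lp_qnorm (lebesgue_on I) p01).
Local Notation L f := (Lp_of_testfun I p01 f).
Local Notation Sob k := (sobolev_qnorm I p01 k).

(** The identity on which everything rests: up to the exponent, the norm of
    W^{k+1,p} is the sum of those of the two components of (alpha, delta). *)
Lemma sobolev_normpS k (f : testfun R) :
  Sob k.+1 f `^ p = Lpq (L f) `^ p + Sob k (testfun_derive f) `^ p.
Proof.
have a (x y z x' y' z' : R) : x = x' -> y = y' -> z = z' ->
  x' = y' + z' -> x = y + z by move=> -> -> ->.
apply: (a _ _ _ _ _ _ (sobolev_normpE I p01 k.+1 f) erefl
  (sobolev_normpE I p01 k (testfun_derive f))).
rewrite big_ord_recl; congr (_ + _); apply: eq_bigr => i _.
by rewrite -derive1nE.
Qed.

Lemma Lp_le_sobolev k (f : testfun R) : Lpq (L f) `^ p <= Sob k f `^ p.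
Proof.
rewrite [leRHS](sobolev_normpE I p01 k f) big_ord_recl lerDl.
by apply: sumr_ge0 => i _; exact: powR_ge0.
Qed.

Let LB (f g : testfun R) : L (f - g) = L f - L g.
Proof. exact: val_inj. Qed.

(** As alpha is defined by a choice of limit, its value carries information only
    because the limit exists, by completeness of L^p. *)
Lemma alphaP k (u : cauchyseq (Sob k)) (l : Lpfun (lebesgue_on I) p01) :
  alpha (\pi_(sobolev I p01 k) u) = \pi_(LpI I p01) l <->
  Lpq (l - L (u j)) @[j --> \oo] --> 0.
Proof.
have uC : is_cauchy Lpq (fun j => L (u j)).
  apply/is_cauchyP => e e0.
  have /is_cauchyP/(_ _ e0)[n0 h] := cauchyseqP u.
  exists n0 => m n nm nn; rewrite -LB.
  exact: le_lt_trans (Lp_le_sobolev k _) (h m n nm nn).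
have lim (l' : Lpfun (lebesgue_on I) p01) :
    Lpq (l' - L (u j)) @[j --> \oo] --> 0 ->
    alpha (\pi_(sobolev I p01 k) u) = \pi_(LpI I p01) l'.
  move=> /qnorm_cvg0P ul'; rewrite alpha_pi; apply: cvg_lim.
    exact: metric_hausdorff.
  apply/metric_structure.metricType_numDomainType.cvgrPdist_le => e e0.
  have [n0 h] := ul' _ e0; exists n0 => // n /= /h.
  rewrite /mdist/= /sepquot_dist -raddfB sepquot_norm_pi; exact.
have /Lp_complete[l' hl'] := uC.
have ul' : Lpq (l' - L (u j)) @[j --> \oo] --> 0 by exact/qnorm_cvg0P.
split=> [|/lim//]; rewrite (lim _ ul') => /sepquotP ll'.
rewrite (_ : (fun j => _) = (fun j => Lpq (l' - L (u j))))//.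
by apply/funext => j; apply/esym/qn_eq0_l; rewrite opprB addrA subrK.
Qed.

(** If (u_j) and (s_j) have the same limit in L^p and their derivatives are
    equivalent, both terms of the norm of s_j - u_j tend to 0. *)
Lemma alpha_delta_injective k (v w : sobolev I p01 k.+1) :
  alpha v = alpha w -> delta v = delta w -> v = w.
Proof.
rewrite -[v]reprK -[w]reprK; set s := repr v; set u := repr w.
move=> ha hd; have [l ul] : exists l,
    alpha (\pi_(sobolev I p01 k.+1) u) = \pi_(LpI I p01) l.
  by eexists; exact: esym (reprK _).
move: (ha); rewrite ul => /alphaP/qnorm_cvg0P sl.
move/alphaP/qnorm_cvg0P : ul => ul.
move: hd; rewrite !delta_pi => /(completionP (N := Sob k))/qnorm_cvg0P su.
apply/(completionP (N := Sob k.+1))/qnorm_cvg0P => e e0.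
have e30 : 0 < e / 3 by rewrite divr_gt0.
have [n1 h1] := sl _ e30; have [n2 h2] := ul _ e30; have [n3 h3] := su _ e30.
exists (maxn n1 (maxn n2 n3)) => n; rewrite !geq_max => /and3P[/h1 a1 /h2 a2 /h3 a3].
rewrite sobolev_normpS testfun_deriveB.
have -> : e = (e / 3 + e / 3) + e / 3 by field.
apply: lerD => //; apply: le_trans (lerD a2 a1).
rewrite -[X in _ <= _ + X `^ _]qnN; apply: le_trans (qnD Lpq _ _).
have -> : L (s n - u n) = (l - L (u n)) - (l - L (s n)).
  by rewrite LB opprB [RHS]addrC addrA subrK.
exact: lexx.
Qed.

(** Take F with F' close to g, then subtract from F a late term of a sequence
    representing beta F: such terms approach F in L^p, and their derivatives
    tend to 0. *)
Lemma graph_dense k (beta : LpI I p01 -> sobolev I p01 k.+1) :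
  (forall f, alpha (beta f) = f) -> (forall f, delta (beta f) = 0) ->
  forall (g : testfun R) (e : R), 0 < e -> exists f : testfun R,
    Lpq (L f) `^ p <= e /\ Sob k (testfun_derive f - g) `^ p <= e.
Proof.
move=> ab db g e e0; have e20 : 0 < e / 2 by rewrite divr_gt0.
have [F Fg] := derive_dense R I p p01 k g _ e20.
pose s := repr (beta (\pi_(LpI I p01) (L F))).
have := ab (\pi_(LpI I p01) (L F)).
rewrite -[beta _]reprK => /alphaP/qnorm_cvg0P/(_ _ e0)[n1 h1].
have := db (\pi_(LpI I p01) (L F)).
rewrite -[beta _]reprK delta_pi -[0](raddf0 (\pi_(sobolev I p01 k))).
move=> /(completionP (N := Sob k))/qnorm_cvg0P/(_ _ e20)[n2 h2].
pose n := maxn n1 n2; exists (F - s n); split.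
  by rewrite LB; apply: h1; exact: leq_maxl.
rewrite testfun_deriveB addrAC (splitr e).
apply: (le_trans (qnD (Sob k) (testfun_derive F - g) (- testfun_derive (s n)))).
rewrite (qnN (Sob k) (testfun_derive (s n))).
apply: lerD; first exact: ltW Fg.
have := h2 n (leq_maxr _ _); rewrite subr0; exact.
Qed.

Lemma cauchy_of_graph k (f : nat -> testfun R) :
  is_cauchy Lpq (fun j => L (f j)) ->
  is_cauchy (Sob k) (fun j => testfun_derive (f j)) ->
  is_cauchy (Sob k.+1) f.
Proof.
move=> /is_cauchyP fC /is_cauchyP dC; apply/is_cauchyP => e e0.
have e20 : 0 < e / 2 by rewrite divr_gt0.
have [n1 h1] := fC _ e20; have [n2 h2] := dC _ e20.
exists (maxn n1 n2) => m n; rewrite !geq_max => /andP[m1 m2] /andP[k1 k2].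
rewrite sobolev_normpS testfun_deriveB LB (splitr e).
by rewrite ltrD ?h1 ?h2.
Qed.

End sobolev_graph.

Theorem lemma3 (R : realType) (I : interval R) (p : R) (p01 : 0 < p < 1)
    (k : nat) (beta : {linear LpI I p01 -> sobolev I p01 k.+1})
    (beta_continuous : continuous beta)
    (beta_injective : injective beta)
    (alpha_beta : forall f : LpI I p01, alpha (beta f) = f)
    (delta_beta : forall f : LpI I p01, delta (beta f) = 0) :
  set_surj [set: sobolev I p01 k.+1] [set: sobolev I p01 k] (@delta R I p p01 k)
  /\ [set w : sobolev I p01 k.+1 | delta w = 0] = range beta.
Proof.
split; last first.
  apply/seteqP; split=> [w /= w0|_ [f _ <-]]; last exact: delta_beta.
  exists (alpha w); first by [].
  apply: alpha_delta_injective; first exact: alpha_beta.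
  exact: etrans (delta_beta _) (esym w0).
move=> h _; pose u := repr h.
(* The f_j tend to 0 in L^p, so the preimage of h found here is in the kernel
   of alpha. *)
have /choice[f fP] : forall j, exists f : testfun R,
    Lp_qnorm _ p01 (Lp_of_testfun I p01 f) `^ p <= (1 / 2) ^+ j /\
    sobolev_qnorm I p01 k (testfun_derive f - u j) `^ p <= (1 / 2) ^+ j.
  by move=> j; apply: graph_dense alpha_beta delta_beta _ _ _; rewrite exprn_gt0.
have geo (e : R) : 0 < e -> exists n0, forall n, (n0 <= n)%N -> (1 / 2) ^+ n <= e.
  have : (1 / 2 : R) ^+ n @[n --> \oo] --> 0.
    by apply: cvg_expr; rewrite ger0_norm//; lra.
  move=> /cvgrPdist_le + e0 => /(_ _ e0)[n0 _ hn]; exists n0 => n /hn.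
  by rewrite /= sub0r normrN ger0_norm// exprn_ge0.
have df : sobolev_qnorm I p01 k (testfun_derive (f j) - u j) @[j --> \oo] --> 0.
  apply/qnorm_cvg0P => e /geo[n0 hn]; exists n0 => n /hn; apply: le_trans.
  by have [] := fP n.
have fC : is_cauchy (sobolev_qnorm I p01 k.+1) f.
  apply: cauchy_of_graph.
    apply: (is_cauchy_cvg0 _ _ (fun=> 0)).
      by move=> e e0; exists 0%N => m n _ _; rewrite subrr qn0.
    apply/qnorm_cvg0P => e /geo[n0 hn]; exists n0 => n /hn; apply: le_trans.
    by rewrite subr0; have [] := fP n.
  exact: is_cauchy_cvg0 (cauchyseqP u) df.
have fC' : f \in cauchypred (sobolev_qnorm I p01 k.+1) by rewrite inE.
exists (\pi_(sobolev I p01 k.+1)%qT (CauchySeq fC')) => //.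
rewrite delta_pi -[h]reprK.
exact/(completionP (N := sobolev_qnorm I p01 k)).
Qed.
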